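(* Let $(V,\mu)$ be a simple, strongly connected, finite weighted directed graph. Assume that $K>0$ and that $$\operatorname{diam} V=\frac{\Lambda}{K}.$$ Then $(V,\mu)$ is spherically suspended with poles $(x,y)$ for any $x,y\in V$ with $d(x,y)=\operatorname{diam} V$.
   Context: **Graphs.** A finite weighted directed graph $(V,\mu)$ consists of a finite vertex set $V$ and an edge weight $\mu:V\times V\to[0,\infty)$ (not necessarily symmetric), written $\mu_{xy}=\mu(x,y)$; there is a directed edge $x\rightarrow y$ if and only if $\mu_{xy}>0$. It is simple if $\mu_{xx}=0$ for all $x\in V$. A directed path from $x$ to $y$ of length $l$ is a sequence $\{x_i\}_{i=0}^l$ with $x_0=x$, $x_l=y$, $x_i\rightarrow x_{i+1}$ for $i=0,\dots,l-1$. $(V,\mu)$ is strongly connected if for all $x,y\in V$ there is a directed path from $x$ to $y$. Graphs are assumed to have at least two vertices. The (non-symmetric) distance $d(x,y)$ is the minimum length of directed paths from $x$ to $y$; a minimal geodesic from $x$ to $y$ is a directed path from $x$ to $y$ of length $d(x,y)$; $\operatorname{diam}V=\sup_{x,y\in V}d(x,y)$. **Laplacian.** Put $\mu(x)=\sum_{y\in V}\mu_{xy}$ and $P(x,y)=\mu_{xy}/\mu(x)$. The Perron measure $\mathfrak m:V\to(0,1]$ is the unique probability measure with $\mathfrak m(x)=\sum_{y\in V}\mathfrak m(y)P(y,x)$ for all $x$. Put $\overleftarrow P(x,y)=\frac{\mathfrak m(y)}{\mathfrak m(x)}P(y,x)$ and $\mathcal P=\frac12(P+\overleftarrow P)$.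 The Chung Laplacian acts on $f:V\to\mathbb R$ by $\mathcal Lf(x)=f(x)-\sum_{y\in V}\mathcal P(x,y)f(y)$. **Ricci curvature.** For probability measures $\nu_0,\nu_1$ on $V$, the Wasserstein distance is $W(\nu_0,\nu_1)=\inf_\pi\sum_{x,y\in V}d(x,y)\pi(x,y)$, the infimum over all couplings $\pi$ of $(\nu_0,\nu_1)$ (i.e. $\sum_y\pi(x,y)=\nu_0(x)$, $\sum_x\pi(x,y)=\nu_1(y)$). For $\epsilon\in[0,1]$ let $\nu^\epsilon_x(z)=(1-\epsilon)\delta_x(z)+\epsilon\,\mathcal P(x,z)$, where $\delta_x$ is the Dirac measure. For $x\neq y$ let $\kappa_\epsilon(x,y)=1-\frac{W(\nu^\epsilon_x,\nu^\epsilon_y)}{d(x,y)}$ and $\kappa(x,y)=\lim_{\epsilon\to0}\kappa_\epsilon(x,y)/\epsilon$ with $\epsilon>0$ (this limit exists). Set $K:=\inf_{x\rightarrow y}\kappa(x,y)$, the infimum over all $x,y\in V$ with $x\rightarrow y$. **Mean curvature.** Let $\rho_x(z)=d(x,z)$, $\overleftarrow\rho_x(z)=d(z,x)$, $\mathcal H_x=\mathcal L\rho_x(x)$, $\overleftarrow{\mathcal H}_x=\mathcal L\overleftarrow\rho_x(x)$, $\mathcal H(x,y)=-(\mathcal H_x+\overleftarrow{\mathcal H}_y)$ for $x,y\in V$, and $\Lambda:=\sup_{x,y\in V}\mathcal H(x,y)$. **Spherical suspension.** For $x\neq y$ in $V$, $(V,\mu)$ is spherically suspended with poles $(x,y)$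 if: (1) $V=\{z\in V\mid d(x,z)+d(z,y)=d(x,y)\}$; (2) for every minimal geodesic $\{x_i\}_{i=0}^{d(x,y)}$ from $x$ to $y$, $\kappa(x_i,x_j)=K$ for all $i,j\in\{0,\dots,d(x,y)\}$ with $i<j$; (3) $\mathcal H(x,y)=\Lambda$. *)

(* Defs.v *)
From HB Require Import structures.
From mathcomp Require Import all_boot all_order all_algebra.
From mathcomp Require Import all_classical all_reals all_analysis.

Set Implicit Arguments.
Unset Strict Implicit.
Unset Printing Implicit Defensive.

Import Order.TTheory GRing.Theory Num.Theory.
Import numFieldNormedType.Exports.

Local Open Scope classical_set_scope.
Local Open Scope ring_scope.

Section WeightedDigraph.
Context {R : realType} {V : finType}.
Implicit Types (mu pi : V -> V -> R) (f nu m : V -> R) (x y z : V).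

Definition edge mu : rel V := fun x y => 0 < mu x y.

Definition simple_graph mu : Prop := forall x, mu x x = 0.

(* The vertex sequence x_0, ..., x_l of a directed path is encoded, as in
   path.v, by x = x_0 and the tail p = [:: x_1; ...; x_l], so that the length
   of the directed path is [size p]. *)
Definition dipath mu x y (p : seq V) : bool :=
  path (edge mu) x p && (last x p == y).

Definition strongly_connected mu : Prop :=
  forall x y, exists p : seq V, dipath mu x y p.

Definition dipath_of_length mu x y : pred nat :=
  fun l => [exists p : l.-tuple V, dipath mu x y p].

(* The value 0 when y is not reachable from x is a convention, irrelevant for
   strongly connected graphs. *)
Definition dist mu x y : nat :=
  if pselect (exists l, dipath_of_length mu x y l) is left path_xy
  then ex_minn path_xy else 0%N.

Definition minimal_geodesic mu x y (p : seq V) : bool :=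
  dipath mu x y p && (size p == dist mu x y).

Definition diam mu : nat := (\max_(x : V) \max_(y : V) dist mu x y)%N.

Definition transition mu x y : R := mu x y / \sum_(z : V) mu x z.

Definition is_perron_measure mu m : Prop :=
  [/\ forall x, 0 < m x <= 1,
      \sum_(x : V) m x = 1
    & forall x, m x = \sum_(y : V) m y * transition mu y x].

(* The default value 0 is used only when there is no Perron measure, which
   does not happen for strongly connected graphs. *)
Definition perron_measure mu : V -> R :=
  xget (fun=> 0) [set m | is_perron_measure mu m].

Definition rev_transition mu x y : R :=
  perron_measure mu y / perron_measure mu x * transition mu y x.

Definition mean_transition mu x y : R :=
  2^-1 * (transition mu x y + rev_transition mu x y).

Definition laplacian mu f x : R :=
  f x - \sum_(y : V) mean_transition mu x y * f y.

Definition is_coupling nu0 nu1 pi : Prop :=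
  [/\ forall x y, 0 <= pi x y,
      forall x, \sum_(y : V) pi x y = nu0 x
    & forall y, \sum_(x : V) pi x y = nu1 y].

Definition wasserstein mu nu0 nu1 : R :=
  inf [set \sum_(x : V) \sum_(y : V) (dist mu x y)%:R * pi x y
      | pi in is_coupling nu0 nu1].

Definition lazy_measure mu (eps : R) x z : R :=
  (1 - eps) * (z == x)%:R + eps * mean_transition mu x z.

Definition ricci_eps mu (eps : R) x y : R :=
  1 - wasserstein mu (lazy_measure mu eps x) (lazy_measure mu eps y)
      / (dist mu x y)%:R.

Definition ricci mu x y : R :=
  lim (ricci_eps mu eps x y / eps @[eps --> 0^'+]).

Definition ricci_inf mu : R :=
  inf [set ricci mu e.1 e.2 | e in [set e : V * V | edge mu e.1 e.2]].

Definition mean_curv_out mu x : R :=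
  laplacian mu (fun z => (dist mu x z)%:R) x.

Definition mean_curv_in mu x : R :=
  laplacian mu (fun z => (dist mu z x)%:R) x.

Definition mixed_mean_curv mu x y : R :=
  - (mean_curv_out mu x + mean_curv_in mu y).

Definition mean_curv_sup mu : R :=
  sup [set mixed_mean_curv mu e.1 e.2 | e in [set: V * V]].

Definition spherically_suspended mu x y : Prop :=
  [/\ x != y,
      [set: V] = [set z | (dist mu x z + dist mu z y)%N = dist mu x y],
      forall p : seq V, minimal_geodesic mu x y p ->
        forall i j : nat, (i < j <= dist mu x y)%N ->
          ricci mu (nth x (x :: p) i) (nth x (x :: p) j) = ricci_inf mu
    & mixed_mean_curv mu x y = mean_curv_sup mu].

End WeightedDigraph.

(* Main.v *)
(** Testing the Wasserstein distance against the 1-Lipschitz functions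
    [d(x, .)] and [d(x, y) - d(., y)] gives [d(x, y) kappa(x, y) <= H(x, y)],
    while gluing couplings shows that [d kappa] is superadditive along minimal
    geodesics, so that [kappa >= K] for all pairs. When the diameter equals
    [Lambda / K] and is realised by [(x, y)], all these inequalities are
    equalities, which gives conditions (2) and (3). For (1), the defect
    [F z = d(x, z) + d(z, y) - d(x, y)] is nonnegative, and the same bounds on
    [(x, z)] and [(z, y)] show that [L F z >= 0] wherever [F z = 0]; by this
    minimum principle the zero set of [F] is closed under edges, hence is [V].
    The limit defining [kappa] exists because [eps |-> kappa_eps / eps] is
    nonincreasing, by convexity of the Wasserstein distance. *)

Require Import Defs.
From HB Require Import structures.
From mathcomp Require Import all_boot all_order all_algebra.
From mathcomp Require Import all_classical all_reals all_analysis.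
From mathcomp Require Import zify ring lra.

Set Implicit Arguments.
Unset Strict Implicit.
Unset Printing Implicit Defensive.

Import Order.TTheory GRing.Theory Num.Theory.
Import numFieldNormedType.Exports.

Local Open Scope classical_set_scope.
Local Open Scope ring_scope.

(** * The non-symmetric graph distance and minimal geodesics *)

Section Distance.
Context {R : realType} {V : finType} (mu : V -> V -> R).
Implicit Types (x y z : V) (p : seq V).

Lemma dist_le x y p : dipath mu x y p -> (dist mu x y <= size p)%N.
Proof.
move=> pxy; rewrite /dist; case: pselect => [path_xy|//].
case: ex_minnP => l _; apply.
by apply/existsP; exists (in_tuple p).
Qed.

Lemma dist_refl x : dist mu x x = 0%N.
Proof. by apply/eqP; rewrite -leqn0 (@dist_le x x [::])// /dipath/=. Qed.

Lemma dist_edge x y : edge mu x y -> (dist mu x y <= 1)%N.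
Proof. by move=> xy; apply: (@dist_le x y [:: y]); rewrite /dipath/= xy eqxx. Qed.

Hypothesis mu_connected : strongly_connected mu.

Lemma minimal_geodesic_exists x y : exists p, minimal_geodesic mu x y p.
Proof.
have path_xy : exists l, dipath_of_length mu x y l.
  by have [p pxy] := mu_connected x y; exists (size p); apply/existsP; exists (in_tuple p).
suff : dipath_of_length mu x y (dist mu x y).
  by move=> /existsP[p pxy]; exists p; rewrite /minimal_geodesic pxy size_tuple eqxx.
rewrite /dist; case: pselect => [path_xy'|//].
by case: ex_minnP.
Qed.

Lemma dist_triangle x y z : (dist mu x z <= dist mu x y + dist mu y z)%N.
Proof.
have [p /andP[/andP[px /eqP py] /eqP <-]] := minimal_geodesic_exists x y.
have [q /andP[/andP[qy /eqP qz] /eqP <-]] := minimal_geodesic_exists y z.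
rewrite -size_cat; apply: dist_le.
by rewrite /dipath cat_path px last_cat py qy qz eqxx.
Qed.

Lemma dist_eq0 x y : (dist mu x y == 0)%N = (x == y).
Proof.
apply/idP/eqP => [/eqP d0|->]; last by rewrite dist_refl.
have [[|z p]] := minimal_geodesic_exists x y; rewrite /minimal_geodesic d0.
  by rewrite /dipath/= => /andP[/eqP].
by rewrite andbF.
Qed.

(** Cut the first edge off a minimal geodesic; the triangle inequality forbids a shorter remainder.
    This drives the induction on distance for curvature bounds. *)
Lemma dist_succ x y d : dist mu x y = d.+1 ->
  exists2 z, edge mu x z & dist mu z y = d.
Proof.
move=> dxy; have [[|z p]] := minimal_geodesic_exists x y.
  by rewrite /minimal_geodesic dxy andbF.
rewrite /minimal_geodesic /dipath/= dxy eqSS -andbA.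
move=> /andP[/andP[xz pz] /andP[py /eqP sp]].
exists z => //; apply/eqP; rewrite eqn_leq -{1}sp dist_le/=; last by rewrite /dipath pz.
by have := dist_triangle x z y; have := dist_edge xz; lia.
Qed.

Lemma dist_nth_le x p i j : path (edge mu) x p -> (i <= j <= size p)%N ->
  (dist mu (nth x (x :: p) i) (nth x (x :: p) j) <= j - i)%N.
Proof.
move=> /(pathP x) xp; elim: j => [|j IHj] ij.
  by have -> : i = 0%N by [lia]; rewrite dist_refl.
have [->|ne_ij] := eqVneq i j.+1; first by rewrite dist_refl.
have := dist_triangle (nth x (x :: p) i) (nth x (x :: p) j) (nth x (x :: p) j.+1).
have := IHj ltac:(lia); have := dist_edge (xp j ltac:(lia)); rewrite /=; lia.
Qed.

Lemma dist_diam x y : (dist mu x y <= diam mu)%N.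
Proof.
rewrite /diam; apply: leq_trans (leq_bigmax x).
exact: (@leq_bigmax _ (fun y => dist mu x y) y).
Qed.

End Distance.

(** * The Perron measure and positivity of the averaged kernel *)

Section Perron.
Context {R : realType} {V : finType} (mu : V -> V -> R).
Hypotheses (card_V : (1 < #|V|)%N) (mu_ge0 : forall x y : V, 0 <= mu x y).
Hypothesis mu_connected : strongly_connected mu.
Implicit Types x y z : V.

Lemma connected_ind (P : V -> Prop) x0 : P x0 ->
  (forall x y, edge mu x y -> P x -> P y) -> forall x, P x.
Proof.
move=> P0 Pedge x; have [p] := mu_connected x0 x.
elim: p x0 P0 => [|y p IHp] x0 P0; first by rewrite /dipath/= => /eqP <-.
by rewrite /dipath/= -andbA => /andP[/Pedge /(_ P0)]; exact: IHp.
Qed.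

Lemma exists_out_edge x : exists y, edge mu x y.
Proof.
have [y yx] : exists y, y != x.
  apply/existsP; rewrite -negb_forall; apply/negP => /forallP xE.
  move: card_V; rewrite ltnNge -(card1 x) => /negP; apply.
  by apply/subset_leq_card/fintype.subsetP => y _; exact: xE.
have [d dxy] : exists d, dist mu x y = d.+1.
  exists (dist mu x y).-1; rewrite prednK// lt0n dist_eq0// eq_sym//.
by have [z xz _] := dist_succ mu_connected dxy; exists z.
Qed.

Lemma degree_gt0 x : 0 < \sum_(z : V) mu x z.
Proof.
have [y xy] := exists_out_edge x.
by rewrite (bigD1 y)//= ltr_pwDl// sumr_ge0.
Qed.

Lemma transition_ge0 x y : 0 <= transition mu x y.
Proof. by rewrite divr_ge0// ltW// degree_gt0. Qed.

Lemma transition_gt0 x y : edge mu x y -> 0 < transition mu x y.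
Proof. by move=> xy; rewrite divr_gt0// degree_gt0. Qed.

Lemma transition_sum x : \sum_(y : V) transition mu x y = 1.
Proof. by rewrite -mulr_suml divff// gt_eqF// degree_gt0. Qed.

(** The rows of [P] sum to 1, so [P - 1] kills the constant column and is singular; a singular
    matrix also has a nonzero left null vector. *)
Lemma invariant_vector_exists : exists2 u : V -> R, exists x, u x != 0 &
  forall x, u x = \sum_(y : V) u y * transition mu y x.
Proof.
pose A : 'M[R]_#|V| :=
  \matrix_(i, j) transition mu (enum_val i) (enum_val j) - 1%:M.
have sum_enum (F : V -> R) : \sum_(i < #|V|) F (enum_val i) = \sum_(y : V) F y.
  by rewrite [RHS](big_enum_val (A := V)).
have detA : \det A == 0.
  rewrite -det_tr; apply/det0P; exists (const_mx 1).
    apply/negP => /eqP/rowP /(_ (Ordinal (ltnW card_V))).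
    by rewrite !mxE => /eqP; rewrite oner_eq0.
  apply/rowP => i; rewrite !mxE.
  under eq_bigr do rewrite !mxE mul1r.
  rewrite sumrB (sum_enum (transition mu (enum_val i))) transition_sum.
  by rewrite (bigD1 i)//= eqxx big1 ?addr0 ?subrr// => j ji; rewrite eq_sym (negPf ji).
have [v v0 vA] := det0P detA.
exists (fun x => v 0 (enum_rank x)).
  have /existsP[i vi] : [exists i, v 0 i != 0].
    rewrite -negb_forall; apply/negP => /forallP v0'.
    by move/negP: v0; apply; apply/eqP/rowP => i; rewrite mxE; exact/eqP.
  by exists (enum_val i); rewrite enum_valK.
move=> x; move/rowP: vA => /(_ (enum_rank x)); rewrite !mxE.
under eq_bigr do rewrite !mxE mulrBr.
rewrite sumrB => /eqP; rewrite subr_eq0 => /eqP.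
have -> : \sum_(i < #|V|) v 0 i * (i == enum_rank x)%:R = v 0 (enum_rank x).
  rewrite (bigD1 (enum_rank x))//= eqxx mulr1 big1 ?addr0// => j jx.
  by rewrite (negPf jx) mulr0.
move=> <-; rewrite -sum_enum; apply: eq_bigr => i _.
by rewrite enum_valK enum_rankK.
Qed.

(* If [u] is invariant then so is [|u|]: the inequality [|u| <= |u| P] holds
   pointwise, and both sides have the same total mass. *)
Lemma perron_measure_exists : exists m, is_perron_measure mu m.
Proof.
have [u [x0 ux0] uP] := invariant_vector_exists.
have le_uP x : `|u x| <= \sum_(y : V) `|u y| * transition mu y x.
  rewrite {1}uP; apply: le_trans (ler_norm_sum _ _ _) _.
  by apply: ler_sum => y _; rewrite normrM (ger0_norm (transition_ge0 _ _)).
have absP x : `|u x| = \sum_(y : V) `|u y| * transition mu y x.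
  apply/eqP; rewrite eq_sym -subr_eq0; apply/eqP.
  have/psumr_eq0P : forall x, true -> 0 <= \sum_(y : V) `|u y| * transition mu y x - `|u x|.
    by move=> y _; rewrite subr_ge0.
  apply=> //; rewrite sumrB exchange_big/=.
  under eq_bigr do rewrite -mulr_sumr transition_sum mulr1.
  by rewrite subrr.
(* Invariance carries positivity of [|u|] along edges, so strong connectedness spreads it from [x0]
   to all of [V]. *)
have u_gt0 x : 0 < `|u x|.
  apply: (@connected_ind (fun x => 0 < `|u x|) x0); first by rewrite normr_gt0.
  move=> y z yz uy; rewrite absP (bigD1 y)//= ltr_pwDl//.
    by rewrite mulr_gt0// transition_gt0.
  by apply: sumr_ge0 => w _; rewrite mulr_ge0// transition_ge0.
pose s := \sum_(x : V) `|u x|.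
have le_us x : `|u x| <= s by rewrite /s (bigD1 x)//= lerDl sumr_ge0.
have s_gt0 : 0 < s by exact: lt_le_trans (u_gt0 x0) (le_us x0).
exists (fun x => `|u x| / s); split.
- by move=> x; rewrite divr_gt0//= ler_pdivrMr// mul1r.
- by rewrite -mulr_suml divff// gt_eqF.
- move=> x; rewrite {1}absP mulr_suml; apply: eq_bigr => y _.
  by rewrite mulrAC.
Qed.

Lemma perron_measureP : is_perron_measure mu (perron_measure mu).
Proof. exact: (@xgetPex _ (fun=> 0) [set m | is_perron_measure mu m]) perron_measure_exists. Qed.

Lemma rev_transition_ge0 x y : 0 <= rev_transition mu x y.
Proof.
have [m01 _ _] := perron_measureP.
have /andP[mx _] := m01 x; have /andP[my _] := m01 y.
by rewrite mulr_ge0 ?transition_ge0 ?divr_ge0// ltW.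
Qed.

(** Stochasticity of the reversed kernel is the invariance of the Perron measure, divided by its
    value at [x]. *)
Lemma rev_transition_sum x : \sum_(y : V) rev_transition mu x y = 1.
Proof.
have [m01 _ mP] := perron_measureP; have /andP[mx _] := m01 x.
rewrite /rev_transition; under eq_bigr do rewrite mulrAC.
by rewrite -mulr_suml -mP divff// gt_eqF.
Qed.

Lemma mean_transition_ge0 x y : 0 <= mean_transition mu x y.
Proof. by rewrite mulr_ge0// addr_ge0 ?transition_ge0 ?rev_transition_ge0. Qed.

Lemma mean_transition_gt0 x y : edge mu x y -> 0 < mean_transition mu x y.
Proof. by move=> xy; rewrite mulr_gt0// ltr_pwDl ?transition_gt0 ?rev_transition_ge0. Qed.

Lemma mean_transition_sum x : \sum_(y : V) mean_transition mu x y = 1.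
Proof.
rewrite -mulr_sumr big_split/= transition_sum rev_transition_sum.
by rewrite -mulr2n mulVf.
Qed.

End Perron.

(** * Wasserstein distance: duality, triangle inequality, convexity *)

Section Wasserstein.
Context {R : realType} {V : finType} (mu : V -> V -> R).
Implicit Types (pi : V -> V -> R) (nu f g : V -> R) (x y z : V).

Definition prob_vector nu : Prop :=
  (forall x, 0 <= nu x) /\ \sum_(x : V) nu x = 1.

Definition transport_cost pi : R :=
  \sum_(x : V) \sum_(y : V) (dist mu x y)%:R * pi x y.

Lemma transport_cost_ge0 nu0 nu1 pi : is_coupling nu0 nu1 pi -> 0 <= transport_cost pi.
Proof. by move=> [pi_ge0 _ _]; do 2![apply: sumr_ge0 => ? _]; rewrite mulr_ge0. Qed.

Lemma wasserstein_le_cost nu0 nu1 pi : is_coupling nu0 nu1 pi ->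
  wasserstein mu nu0 nu1 <= transport_cost pi.
Proof.
move=> pi01; apply: ge_inf; last by exists pi.
by exists 0 => _ [pi' /transport_cost_ge0 ? <-].
Qed.

(** Thanks to this coupling, the [inf] in [wasserstein] runs over a nonempty set. *)
Lemma product_coupling nu0 nu1 : prob_vector nu0 -> prob_vector nu1 ->
  is_coupling nu0 nu1 (fun x y => nu0 x * nu1 y).
Proof.
move=> [nu0_ge0 nu0_sum] [nu1_ge0 nu1_sum]; split=> [x y|x|y].
- exact: mulr_ge0.
- by rewrite -mulr_sumr nu1_sum mulr1.
- by rewrite -mulr_suml nu0_sum mul1r.
Qed.

Lemma le_wasserstein c nu0 nu1 : prob_vector nu0 -> prob_vector nu1 ->
  (forall pi, is_coupling nu0 nu1 pi -> c <= transport_cost pi) ->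
  c <= wasserstein mu nu0 nu1.
Proof.
move=> nu0P nu1P c_le; apply: lb_le_inf => [|_ [pi /c_le ? <-]//].
exists (transport_cost (fun x y => nu0 x * nu1 y)), (fun x y => nu0 x * nu1 y) => //.
exact: product_coupling.
Qed.

(* The easy half of Kantorovich duality. *)
Lemma wasserstein_ge_dual nu0 nu1 f g : prob_vector nu0 -> prob_vector nu1 ->
  (forall x y, g y <= f x + (dist mu x y)%:R) ->
  \sum_(y : V) nu1 y * g y - \sum_(x : V) nu0 x * f x <= wasserstein mu nu0 nu1.
Proof.
move=> nu0P nu1P fg; apply: le_wasserstein => // pi [pi_ge0 pi0 pi1].
have -> : \sum_(y : V) nu1 y * g y = \sum_(x : V) \sum_(y : V) pi x y * g y.
  by rewrite exchange_big/=; apply: eq_bigr => y _; rewrite -pi1 mulr_suml.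
have -> : \sum_(x : V) nu0 x * f x = \sum_(x : V) \sum_(y : V) pi x y * f x.
  by apply: eq_bigr => x _; rewrite -pi0 mulr_suml.
rewrite -sumrB; apply: ler_sum => x _; rewrite -sumrB; apply: ler_sum => y _.
by rewrite -mulrBr [leRHS]mulrC ler_wpM2l// lerBlDl.
Qed.

Lemma wasserstein_ge0 nu0 nu1 : prob_vector nu0 -> prob_vector nu1 ->
  0 <= wasserstein mu nu0 nu1.
Proof. by move=> nu0P nu1P; apply: le_wasserstein => // pi /transport_cost_ge0. Qed.

Lemma wasserstein_refl nu : prob_vector nu -> wasserstein mu nu nu = 0.
Proof.
move=> nuP; apply/eqP; rewrite eq_le wasserstein_ge0// andbT.
have <- : transport_cost (fun x y => (x == y)%:R * nu x) = 0.
  rewrite /transport_cost big1// => x _; rewrite big1// => y _.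
  by have [<-|_] := eqVneq x y; rewrite ?dist_refl !(mul0r, mulr0).
apply: wasserstein_le_cost; split=> [x y|x|y].
- by rewrite mulr_ge0// nuP.1.
- rewrite (bigD1 x)//= eqxx mul1r big1 ?addr0// => y yx.
  by rewrite eq_sym (negPf yx) mul0r.
- rewrite (bigD1 y)//= eqxx mul1r big1 ?addr0// => x xy.
  by rewrite (negPf xy) mul0r.
Qed.

Lemma coupling_null nu0 nu1 pi x y : is_coupling nu0 nu1 pi ->
  (nu0 x = 0 -> pi x y = 0) /\ (nu1 y = 0 -> pi x y = 0).
Proof.
move=> [pi_ge0 pi0 pi1]; split.
  by rewrite -pi0 => /psumr_eq0P; apply.
by rewrite -pi1 => /psumr_eq0P; apply.
Qed.

(* Where [nu1] vanishes both couplings vanish too, so that the junk value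
   [0^-1 = 0] is harmless. *)
Lemma glued_coupling nu0 nu1 nu2 pi01 pi12 :
  is_coupling nu0 nu1 pi01 -> is_coupling nu1 nu2 pi12 ->
  is_coupling nu0 nu2 (fun x z => \sum_(y : V) pi01 x y * pi12 y z / nu1 y).
Proof.
move=> c01 c12; have [ge01 l01 r01] := c01; have [ge12 l12 r12] := c12.
have nu1_ge0 y : 0 <= nu1 y by rewrite -r01 sumr_ge0.
split=> [x z|x|z].
- by apply: sumr_ge0 => y _; rewrite divr_ge0// mulr_ge0.
- rewrite exchange_big/= -l01; apply: eq_bigr => y _.
  rewrite -mulr_suml -mulr_sumr l12.
  have [nu1y|?] := eqVneq (nu1 y) 0; last by rewrite mulfK.
  by rewrite nu1y invr0 mulr0 (coupling_null x y c01).2.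
- rewrite exchange_big/= -r12; apply: eq_bigr => y _.
  under eq_bigr do rewrite -mulrA; rewrite -mulr_suml r01.
  have [nu1y|?] := eqVneq (nu1 y) 0; last by rewrite mulrC mulfVK.
  by rewrite nu1y mul0r (coupling_null y z c12).1.
Qed.

Hypothesis mu_connected : strongly_connected mu.

(** Both costs become sums against one joint weight [t x y z] whose pair marginals are [pi01] and
    [pi12]; the triangle inequality for [d] then applies termwise. *)
Lemma glued_cost_le nu0 nu1 nu2 pi01 pi12 :
  is_coupling nu0 nu1 pi01 -> is_coupling nu1 nu2 pi12 ->
  transport_cost (fun x z => \sum_(y : V) pi01 x y * pi12 y z / nu1 y) <=
  transport_cost pi01 + transport_cost pi12.
Proof.
move=> c01 c12; have [ge01 l01 r01] := c01; have [ge12 l12 r12] := c12.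
have nu1_ge0 y : 0 <= nu1 y by rewrite -r01 sumr_ge0.
pose t x y z := pi01 x y * pi12 y z / nu1 y.
have cost01 : transport_cost pi01 =
    \sum_(x : V) \sum_(z : V) \sum_(y : V) (dist mu x y)%:R * t x y z.
  apply: eq_bigr => x _; rewrite exchange_big/=; apply: eq_bigr => y _.
  rewrite -mulr_sumr; congr (_ * _); rewrite /t -mulr_suml -mulr_sumr l12.
  have [nu1y|?] := eqVneq (nu1 y) 0; last by rewrite mulfK.
  by rewrite nu1y mulr0 mul0r (coupling_null x y c01).2.
have cost12 : transport_cost pi12 =
    \sum_(x : V) \sum_(z : V) \sum_(y : V) (dist mu y z)%:R * t x y z.
  rewrite [RHS]exchange_big/= /transport_cost exchange_big/=; apply: eq_bigr => z _.
  rewrite [RHS]exchange_big/=; apply: eq_bigr => y _.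
  rewrite -mulr_sumr; congr (_ * _); rewrite /t -mulr_suml -mulr_suml r01.
  have [nu1y|?] := eqVneq (nu1 y) 0; last by rewrite mulrAC divff ?mul1r.
  by rewrite nu1y !mul0r (coupling_null y z c12).1.
rewrite cost01 cost12 -big_split; apply: ler_sum => x _.
rewrite -big_split; apply: ler_sum => z _.
rewrite mulr_sumr -big_split; apply: ler_sum => y _ /=.
rewrite -mulrDl ler_wpM2r//; first by rewrite divr_ge0// mulr_ge0.
by rewrite -natrD ler_nat dist_triangle.
Qed.

Lemma wasserstein_triangle nu0 nu1 nu2 :
  prob_vector nu0 -> prob_vector nu1 -> prob_vector nu2 ->
  wasserstein mu nu0 nu2 <= wasserstein mu nu0 nu1 + wasserstein mu nu1 nu2.
Proof.
move=> nu0P nu1P nu2P; rewrite -lerBlDl; apply: le_wasserstein => // pi12 c12.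
rewrite lerBlDl -lerBlDr; apply: le_wasserstein => // pi01 c01.
rewrite lerBlDr; apply: le_trans (glued_cost_le c01 c12).
by apply: wasserstein_le_cost; exact: glued_coupling.
Qed.

Lemma dirac_mix_coupling nu0 nu1 pi t x y : is_coupling nu0 nu1 pi -> 0 <= t <= 1 ->
  is_coupling (fun z => (1 - t) * (z == x)%:R + t * nu0 z)
    (fun z => (1 - t) * (z == y)%:R + t * nu1 z)
    (fun z w => (1 - t) * ((z == x)%:R * (w == y)%:R) + t * pi z w).
Proof.
move=> [ge l r] /andP[t0 t1].
have sum_dirac (a : V) : \sum_(b : V) (b == a)%:R = 1 :> R.
  by rewrite (bigD1 a)//= eqxx big1 ?addr0// => b /negPf ->.
split=> [z w|z|w].
- by rewrite addr_ge0// mulr_ge0// ?subr_ge0// mulr_ge0.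
- by rewrite big_split/= -!mulr_sumr sum_dirac mulr1 l.
- by rewrite big_split/= -!mulr_sumr -mulr_suml sum_dirac mul1r r.
Qed.

(** Mixing a coupling with the point mass at [(x, y)] costs [(1 - t) d(x, y)] plus [t] times its own
    cost. *)
Lemma wasserstein_dirac_mix nu0 nu1 t x y : prob_vector nu0 -> prob_vector nu1 ->
  0 < t <= 1 ->
  wasserstein mu (fun z => (1 - t) * (z == x)%:R + t * nu0 z)
    (fun z => (1 - t) * (z == y)%:R + t * nu1 z)
  <= (1 - t) * (dist mu x y)%:R + t * wasserstein mu nu0 nu1.
Proof.
(* Dividing by [t] isolates the infimum on the right, so that it suffices to treat each coupling of
   [nu0] and [nu1]. *)
move=> nu0P nu1P /andP[t0 t1]; rewrite -lerBlDl -ler_pdivrMl//.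
apply: le_wasserstein => // pi c01.
rewrite ler_pdivrMl// lerBlDl.
have c := dirac_mix_coupling x y c01 (introT andP (conj (ltW t0) t1)).
apply: le_trans (wasserstein_le_cost c) _.
rewrite /transport_cost; under eq_bigr do
  [under eq_bigr do rewrite mulrDr mulrCA (mulrCA _ t); rewrite big_split/= -!mulr_sumr].
rewrite big_split/= -!mulr_sumr lerD2r ler_wpM2l ?subr_ge0//.
rewrite (bigD1 x)//= (bigD1 y)//= !eqxx !mulr1 !big1 ?addr0// => z.
  by move=> /negPf zx; rewrite big1// => w _; rewrite zx mul0r mulr0.
by move=> /negPf ->; rewrite !mulr0.
Qed.

End Wasserstein.

(** * Ricci curvature as a limit, and its comparison with the Laplacian *)

Section Curvature.
Context {R : realType} {V : finType} (mu : V -> V -> R).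
Hypotheses (card_V : (1 < #|V|)%N) (mu_ge0 : forall x y : V, 0 <= mu x y).
Hypothesis mu_connected : strongly_connected mu.
Implicit Types (f g : V -> R) (x y z : V) (eps : R).

Lemma lazy_measure_prob eps x : 0 <= eps <= 1 -> prob_vector (lazy_measure mu eps x).
Proof.
move=> /andP[eps0 eps1]; split=> [z|].
  by rewrite addr_ge0// mulr_ge0// ?subr_ge0// mean_transition_ge0.
rewrite big_split/= -mulr_sumr -mulr_sumr mean_transition_sum// (bigD1 x)//= eqxx.
by rewrite big1 ?addr0 ?mulr1 ?subrK// => z /negPf ->.
Qed.

Lemma lazy_measure_mean eps f x :
  \sum_(z : V) lazy_measure mu eps x z * f z = f x - eps * laplacian mu f x.
Proof.
have dirac_mean : \sum_(z : V) (z == x)%:R * f z = f x.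
  by rewrite (bigD1 x)//= eqxx mul1r big1 ?addr0// => z /negPf ->; rewrite mul0r.
have -> : \sum_(z : V) lazy_measure mu eps x z * f z =
    (1 - eps) * f x + eps * \sum_(y : V) mean_transition mu x y * f y.
  rewrite -dirac_mean !mulr_sumr -big_split; apply: eq_bigr => z _.
  by rewrite /lazy_measure mulrDl -!mulrA.
by rewrite /laplacian; ring.
Qed.

(** Puts lazy measures into the shape of [wasserstein_dirac_mix], so that convexity compares two
    values of the laziness parameter. *)
Lemma lazy_measure_mix t eps x : lazy_measure mu (t * eps) x =
  fun z => (1 - t) * (z == x)%:R + t * lazy_measure mu eps x z.
Proof. by apply/funext => z; rewrite /lazy_measure; ring. Qed.

(* [d(x, y) * kappa_eps(x, y) / eps], which unlike [kappa_eps(x, y) / eps] is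
   also meaningful on the diagonal, where it is 0. *)
Definition curv_quot eps x y : R :=
  ((dist mu x y)%:R - wasserstein mu (lazy_measure mu eps x) (lazy_measure mu eps y)) / eps.

Lemma curv_quot_refl eps x : 0 < eps <= 1 -> curv_quot eps x x = 0.
Proof.
move=> /andP[eps0 eps1].
rewrite /curv_quot wasserstein_refl ?dist_refl ?subrr ?mul0r//.
by apply: lazy_measure_prob; rewrite ltW.
Qed.

(** By [lazy_measure_mean], the dual value of [(f, g)] is [d(x, y) - eps * (L g y - L f x)];
    dividing by [eps] leaves a bound free of [eps]. *)
Lemma curv_quot_le f g eps x y : 0 < eps <= 1 ->
  (forall z w, g w <= f z + (dist mu z w)%:R) ->
  g y = f x + (dist mu x y)%:R ->
  curv_quot eps x y <= laplacian mu g y - laplacian mu f x.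
Proof.
move=> /andP[eps0 eps1] fg gy.
have probP z : prob_vector (lazy_measure mu eps z).
  by apply: lazy_measure_prob; rewrite ltW.
have := wasserstein_ge_dual (probP x) (probP y) fg.
rewrite !lazy_measure_mean gy => W_ge.
rewrite ler_pdivrMr//; lra.
Qed.

Lemma curv_quot_antitone s t x y : 0 < s -> s <= t -> t <= 1 ->
  curv_quot t x y <= curv_quot s x y.
Proof.
move=> s0 st t1; have t0 := lt_le_trans s0 st.
have probP z : prob_vector (lazy_measure mu t z).
  by apply: lazy_measure_prob; rewrite ltW.
(* The measure with parameter [s] is a Dirac measure mixed, with weight [s / t], with the measure of
   parameter [t]. *)
have st01 : 0 < s / t <= 1 by rewrite divr_gt0//= ler_pdivrMr ?mul1r.
have := wasserstein_dirac_mix mu x y (probP x) (probP y) st01.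
rewrite -!lazy_measure_mix divfK ?gt_eqF// => W_le.
rewrite /curv_quot ler_pdivlMr// mulrAC -mulrA; lra.
Qed.

Lemma curv_quot_superadd eps x y z : 0 < eps <= 1 ->
  dist mu x z = (dist mu x y + dist mu y z)%N ->
  curv_quot eps x y + curv_quot eps y z <= curv_quot eps x z.
Proof.
move=> /andP[eps0 eps1] dxz.
have probP w : prob_vector (lazy_measure mu eps w).
  by apply: lazy_measure_prob; rewrite ltW.
have := wasserstein_triangle mu_connected (probP x) (probP y) (probP z).
rewrite /curv_quot -mulrDl ler_pM2r ?invr_gt0// dxz natrD; lra.
Qed.

Lemma dist_triangleR x y z : (dist mu x z)%:R <= (dist mu x y)%:R + (dist mu y z)%:R :> R.
Proof. by rewrite -natrD ler_nat dist_triangle. Qed.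

Lemma near_unit_interval : \forall eps \near (0 : R)^'+, 0 < eps <= 1.
Proof.
near=> eps; apply/andP; split; first by near: eps; exact: nbhs_right_gt.
by near: eps; exact: nbhs_right_ltW.
Unshelve. all: by end_near. Qed.

Lemma curv_quot_is_cvg x y : cvg (curv_quot eps x y @[eps --> 0^'+]).
Proof.
apply/cvg_ex; eexists.
apply: (@nonincreasing_at_right_cvgr _ _ _ (BRight 1)) => /=.
- by rewrite bnd_simp.
- move=> s t; rewrite !in_itv/= => /andP[s0 s1] /andP[t0 t1] ts.
  exact: curv_quot_antitone.
(* Taking [d(x, .)] for both dual functions bounds the quotient above on the whole interval; a
   monotone bounded function has a one-sided limit. *)
- pose f z : R := (dist mu x z)%:R.
  exists (laplacian mu f y - laplacian mu f x) => _ [eps + <-].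
  rewrite /= in_itv/= => eps01; apply: curv_quot_le => // [z w|].
    exact: dist_triangleR.
  by rewrite /f dist_refl add0r.
Qed.

(** Makes the [lim] in [ricci] a true limit off the diagonal. On the diagonal the factor
    [d(x, x) = 0] kills whatever value [ricci] takes. *)
Lemma curv_quot_cvg x y :
  curv_quot eps x y @[eps --> 0^'+] --> (dist mu x y)%:R * ricci mu x y.
Proof.
have [<-|xy] := eqVneq x y.
  rewrite dist_refl mul0r; apply: cvg_near_cst.
  by apply: filterS near_unit_interval => eps eps01; rewrite curv_quot_refl.
have d0 : (dist mu x y)%:R != 0 :> R by rewrite pnatr_eq0 dist_eq0.
have -> : ricci mu x y = (dist mu x y)%:R^-1 * lim (curv_quot eps x y @[eps --> 0^'+]).
  apply: cvg_lim => //.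
  have -> : (fun eps => ricci_eps mu eps x y / eps) =
      (fun eps => (dist mu x y)%:R^-1 * curv_quot eps x y).
    apply/funext => eps; rewrite /curv_quot mulrA; congr (_ / eps).
    by rewrite mulrBr mulVf// mulrC.
  by apply: cvgM; [exact: cvg_cst|exact: curv_quot_is_cvg].
by rewrite mulVKf//; exact: curv_quot_is_cvg.
Qed.

Lemma ricci_le f g x y :
  (forall z w, g w <= f z + (dist mu z w)%:R) ->
  g y = f x + (dist mu x y)%:R ->
  (dist mu x y)%:R * ricci mu x y <= laplacian mu g y - laplacian mu f x.
Proof.
move=> fg gy; pose c := laplacian mu g y - laplacian mu f x.
apply: (ler_cvg_to (@curv_quot_cvg x y) (cvg_cst c)).
by apply: filterS near_unit_interval => eps eps01; exact: curv_quot_le.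
Qed.

Lemma ricci_superadd x y z : dist mu x z = (dist mu x y + dist mu y z)%N ->
  (dist mu x y)%:R * ricci mu x y + (dist mu y z)%:R * ricci mu y z
  <= (dist mu x z)%:R * ricci mu x z.
Proof.
move=> dxz.
apply: (ler_cvg_to (cvgD (@curv_quot_cvg x y) (@curv_quot_cvg y z)) (@curv_quot_cvg x z)).
by apply: filterS near_unit_interval => eps eps01; exact: curv_quot_superadd.
Qed.

(** Induction on [d(x, y)]: peel off the first edge of a geodesic and apply superadditivity. *)
Lemma ricci_ge_edge (k : R) : simple_graph mu ->
  (forall x y, edge mu x y -> k <= ricci mu x y) ->
  forall x y, k * (dist mu x y)%:R <= (dist mu x y)%:R * ricci mu x y.
Proof.
move=> mu_simple k_le x y; move dxyE : (dist mu x y) => d.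
elim: d x dxyE => [|d IHd] x dxy; first by rewrite mulr0 mul0r.
have [z xz dzy] := dist_succ mu_connected dxy.
(* Without loops an edge joins distinct vertices, so its distance is exactly 1. *)
have dxz : dist mu x z = 1%N.
  apply/eqP; rewrite eqn_leq dist_edge// lt0n dist_eq0//.
  by apply: contraTneq xz => <-; rewrite /edge mu_simple ltxx.
have := @ricci_superadd x z y; rewrite dxy dxz dzy => /(_ erefl).
apply: le_trans; rewrite mul1r mulrS mulrDr mulr1 lerD ?k_le// IHd//.
Qed.

Lemma ricci_ge_inf x y : simple_graph mu -> 0 < ricci_inf mu ->
  ricci_inf mu * (dist mu x y)%:R <= (dist mu x y)%:R * ricci mu x y.
Proof.
move=> mu_simple K_gt0; apply: ricci_ge_edge => // {}x {}y xy.
apply: ge_inf; last by exists (x, y).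
(* If the set had no lower bound, [inf] would take its default value 0, against [K > 0]. *)
by apply: contrapT => lb; move: K_gt0; rewrite /ricci_inf inf_out ?ltxx// => -[].
Qed.

Lemma ricci_le_mean_curv x y :
  (dist mu x y)%:R * ricci mu x y <= mixed_mean_curv mu x y.
Proof.
pose f z : R := (dist mu x z)%:R; pose h z : R := (dist mu z y)%:R.
pose g z : R := (dist mu x y)%:R - h z.
(* The constant [d(x, y)] in [g] drops out of the Laplacian because the rows of the averaged kernel
   sum to 1. *)
have -> : mixed_mean_curv mu x y = laplacian mu g y - laplacian mu f x.
  rewrite /mixed_mean_curv opprD addrC; congr (_ + _).
  rewrite /mean_curv_in /laplacian /g -/h.
  under [X in _ = _ - X]eq_bigr do rewrite mulrBr.
  rewrite sumrB -mulr_suml mean_transition_sum// mul1r; ring.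
(* The dual condition is the triangle inequality along [x, z, w, y]. *)
apply: ricci_le => [z w|]; last by rewrite /g /h /f !dist_refl subr0 add0r.
rewrite /g /h /f lerBlDr; apply: le_trans (dist_triangleR x z y) _.
by rewrite -addrA lerD2l dist_triangleR.
Qed.

End Curvature.

(** * Rigidity when [H(x, y) = K d(x, y)] *)

Section Rigidity.
Context {R : realType} {V : finType} (mu : V -> V -> R).
Hypotheses (card_V : (1 < #|V|)%N) (mu_ge0 : forall x y : V, 0 <= mu x y).
Hypotheses (mu_simple : simple_graph mu) (mu_connected : strongly_connected mu).
Hypothesis K_gt0 : 0 < ricci_inf mu.
Variables x y : V.
Hypothesis mean_curv_eq :
  mixed_mean_curv mu x y = ricci_inf mu * (dist mu x y)%:R.

(** The lower bound by [K] and the upper bound by mean curvature coincide here. *)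
Lemma ricci_poles : (dist mu x y)%:R * ricci mu x y = ricci_inf mu * (dist mu x y)%:R.
Proof. by apply/eqP; rewrite eq_le ricci_ge_inf// andbT -mean_curv_eq ricci_le_mean_curv. Qed.

(** The inequality places [z], [w] in this order on a geodesic. The three pieces have [d * kappa] at
    least [K] times their lengths and total at most [K d(x, y)], so each is an equality. *)
Lemma ricci_geodesic z w : z != w ->
  (dist mu x z + dist mu z w + dist mu w y <= dist mu x y)%N ->
  ricci mu z w = ricci_inf mu.
Proof.
move=> zw dle.
have dzy := dist_triangle mu_connected z w y.
have dxy := dist_triangle mu_connected x z y.
have dxyE : dist mu x y = (dist mu x z + dist mu z y)%N by lia.
have dzyE : dist mu z y = (dist mu z w + dist mu w y)%N by lia.
have := ricci_superadd card_V mu_ge0 mu_connected dxyE.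
have := ricci_superadd card_V mu_ge0 mu_connected dzyE.
have K_le a b := ricci_ge_inf card_V mu_ge0 mu_connected a b mu_simple K_gt0.
have := K_le x z; have := K_le w y; have := K_le z w.
have dzw : 0 < (dist mu z w)%:R :> R by rewrite ltr0n lt0n dist_eq0.
rewrite ricci_poles dxyE dzyE !natrD => Kzw Kwy Kxz Czy Cxy.
apply: (mulfI (lt0r_neq0 dzw)); apply/eqP; rewrite eq_le; apply/andP; split; lra.
Qed.

(* The defect [F z = d(x, z) + d(z, y) - d(x, y)] is nonnegative, and where it
   vanishes the curvature bounds along [x, z, y] force [L F z >= 0]; hence [F]
   vanishes at all neighbours of [z] too. *)
Lemma suspension_propagates z w : edge mu z w ->
  (dist mu x z + dist mu z y)%N = dist mu x y ->
  (dist mu x w + dist mu w y)%N = dist mu x y.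
Proof.
move=> zw dz.
pose f a : R := (dist mu x a)%:R; pose h a : R := (dist mu a y)%:R.
pose D : R := (dist mu x y)%:R.
have K_le a b := ricci_ge_inf card_V mu_ge0 mu_connected a b mu_simple K_gt0.
have outer : ricci_inf mu * f z <= laplacian mu f z - laplacian mu f x.
  apply: le_trans (K_le x z) _; apply: ricci_le => // [a b|].
    exact: dist_triangleR.
  by rewrite /f dist_refl add0r.
(* The sign matters as [d] is not symmetric: it is [- d(., y)] that grows by at most [d(a, b)] from
   [a] to [b]. *)
have inner : ricci_inf mu * h z <= laplacian mu h z - laplacian mu h y.
  have lapN a : laplacian mu (fun b => - h b) a = - laplacian mu h a.
    rewrite /laplacian; under eq_bigr do rewrite mulrN.
    by rewrite sumrN opprD.
  apply: le_trans (K_le z y) _.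
  have -> : laplacian mu h z - laplacian mu h y =
      laplacian mu (fun b => - h b) y - laplacian mu (fun b => - h b) z.
    by rewrite !lapN opprK addrC.
  apply: ricci_le => // [a b|]; last by rewrite /h dist_refl oppr0 addNr.
  by rewrite -lerBlDl opprK addrC lerBlDr dist_triangleR.
have mean_curvE : - (laplacian mu f x + laplacian mu h y) = ricci_inf mu * D.
  by rewrite -mean_curv_eq.
have fhz : f z + h z = D by rewrite -natrD dz.
have fh_ge b : 0 <= f b + h b - D by rewrite subr_ge0 dist_triangleR.
have lap_sum : \sum_(b : V) mean_transition mu z b * (f b + h b - D) =
    - (laplacian mu f z + laplacian mu h z).
  have -> : \sum_(b : V) mean_transition mu z b * (f b + h b - D) =
      \sum_(b : V) mean_transition mu z b * f b +
      \sum_(b : V) mean_transition mu z b * h b - D.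
    rewrite -[X in _ - X]mul1r -(mean_transition_sum card_V mu_ge0 mu_connected z).
    rewrite mulr_suml -big_split -sumrB; apply: eq_bigr => b _ /=; ring.
  by rewrite /laplacian -fhz; ring.
have term_ge0 b : true -> 0 <= mean_transition mu z b * (f b + h b - D).
  by move=> _; rewrite mulr_ge0// mean_transition_ge0.
(* Adding [outer] and [inner], the terms in [K] cancel against [H(x, y) = K D]; the average of the
   nonnegative defect is thus at most 0. *)
have : \sum_(b : V) mean_transition mu z b * (f b + h b - D) = 0.
  apply/eqP; rewrite eq_le sumr_ge0// andbT lap_sum.
  move: outer inner mean_curvE; rewrite -fhz mulrDr; lra.
move=> /(psumr_eq0P term_ge0) /(_ w erefl) /eqP.
rewrite mulf_eq0 gt_eqF ?mean_transition_gt0//= subr_eq0 -natrD eqr_nat.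
by move/eqP.
Qed.

Lemma suspension_everywhere z : (dist mu x z + dist mu z y)%N = dist mu x y.
Proof.
apply: (connected_ind mu_connected
  (P := fun z => (dist mu x z + dist mu z y)%N = dist mu x y) (x0 := x)).
  by rewrite dist_refl.
exact: suspension_propagates.
Qed.

End Rigidity.

(** * Verification of the suspension conditions *)

Theorem theorem1p2 (R : realType) (V : finType) (mu : V -> V -> R)
    (card_V : (1 < #|V|)%N)
    (mu_ge0 : forall x y : V, 0 <= mu x y)
    (mu_simple : simple_graph mu)
    (mu_connected : strongly_connected mu)
    (K_gt0 : 0 < ricci_inf mu)
    (diam_max : (diam mu)%:R = mean_curv_sup mu / ricci_inf mu) :
  forall x y : V, dist mu x y = diam mu -> spherically_suspended mu x y.
Proof.
move=> x y dxy.
have diam_gt0 : (0 < diam mu)%N.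
  have [z xz] := exists_out_edge card_V mu_connected x.
  apply: leq_trans (dist_diam mu x z).
  rewrite lt0n dist_eq0//; apply: contraTneq xz => <-.
  by rewrite /edge mu_simple ltxx.
have supE : mean_curv_sup mu = ricci_inf mu * (dist mu x y)%:R.
  by rewrite dxy diam_max mulrC divfK ?gt_eqF.
have H_le a b : mixed_mean_curv mu a b <= mean_curv_sup mu.
  apply: ub_le_sup; last by exists (a, b).
  (* An unbounded set would have [sup] equal to the default 0, whereas [Lambda = K * diam] is
     positive. *)
  apply: contrapT => ub; have : 0 < mean_curv_sup mu.
    by rewrite supE dxy mulr_gt0// ltr0n.
  by rewrite /mean_curv_sup sup_out ?ltxx// => -[].
(* The supremum gives [H <= Lambda = K d], and the curvature bounds give [K d <= d * kappa <= H]. *)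
have H_eq : mixed_mean_curv mu x y = ricci_inf mu * (dist mu x y)%:R.
  apply/eqP; rewrite eq_le -{1}supE H_le/=.
  apply: le_trans (ricci_ge_inf card_V mu_ge0 mu_connected x y mu_simple K_gt0) _.
  exact: ricci_le_mean_curv.
split.
- by rewrite -(dist_eq0 mu_connected) dxy -lt0n.
- apply/seteqP; split=> z _ //=; exact: suspension_everywhere.
- move=> p /andP[/andP[xp /eqP py] /eqP sp] i j /andP[ij jd].
  (* The three bounds add up to [size p = d(x, y)], which is the ordering hypothesis of
     [ricci_geodesic]. *)
  have dx : (dist mu x (nth x (x :: p) i) <= i)%N.
    by have := dist_nth_le mu_connected (i := 0) (j := i) xp; rewrite subn0 /=; apply; lia.
  have dij : (dist mu (nth x (x :: p) i) (nth x (x :: p) j) <= j - i)%N.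
    by apply: dist_nth_le => //; lia.
  have dy : (dist mu (nth x (x :: p) j) y <= size p - j)%N.
    rewrite -{1}py (last_nth x); apply: dist_nth_le => //; lia.
  apply: (ricci_geodesic card_V mu_ge0 mu_simple mu_connected K_gt0 H_eq); last lia.
  (* Were the two vertices equal, skipping the positive stretch [j - i] would make [d(x, y)] less
     than [size p]. *)
  rewrite -(dist_eq0 mu_connected).
  have := dist_triangle mu_connected x (nth x (x :: p) i) y.
  have := dist_triangle mu_connected (nth x (x :: p) i) (nth x (x :: p) j) y.
  lia.
- by rewrite H_eq supE.
Qed.
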